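(* Let $\alpha>0$ and let $m\ge2$ be a fixed integer. For each $n$, let $r=|\mathcal{P}_n'(m)|$, let $x_1,\dots,x_r$ be the list of the values $\lambda_\kappa$ as $\kappa$ ranges over $\mathcal{P}_n'(m)$, and let $$\bar x=\frac1r\sum_{i=1}^r x_i,\qquad s^2=\frac{1}{r-1}\sum_{i=1}^r(x_i-\bar x)^2$$ be their sample mean and sample variance. Then, as $n\to\infty$, $$\frac{\bar x}{n^2}\to\frac{\alpha}{m+1}\qquad\text{and}\qquad\frac{s^2}{n^4}\to\frac{(m-1)\alpha^2}{(m+1)^2(m+2)(m+3)}.$$
   Context: $\mathcal{P}_n'(m)$ is the set of partitions of $n$ with exactly $m$ parts, i.e. $\kappa=(k_1,\dots,k_m)$ with $k_1\ge\cdots\ge k_m>0$ and $\sum_i k_i=n$. $\kappa'$ denotes the transpose (conjugate) partition, with parts $k_i'$, and $a(\kappa)=\sum_{i=1}^m(i-1)k_i=\sum_{i\ge1}\binom{k_i'}{2}$. The eigenvalue associated with $\kappa$ is $$\lambda_\kappa=n(m-1)+a(\kappa')\alpha-a(\kappa).$$ The list $x_1,\dots,x_r$ is indexed by partitions, so values are repeated if several $\kappa$ give the same $\lambda_\kappa$. *)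

(* Defs.v *)
From mathcomp Require Import all_boot all_order all_algebra.
From mathcomp Require Import all_classical all_reals all_analysis.

Set Implicit Arguments.
Unset Strict Implicit.
Unset Printing Implicit Defensive.

Import Order.TTheory GRing.Theory Num.Theory.

Local Open Scope ring_scope.

Definition is_intpart (n m : nat) (k : seq nat) : bool :=
  [&& size k == m, sorted geq k, all (leq 1) k & sumn k == n].

(* No part exceeds n, so it is enough to search the m-tuples over
   {0, ..., n}; see mem_intparts and uniq_intparts. *)
Definition intparts (n m : nat) : seq (seq nat) :=
  [seq k <- [seq map val (tval t) | t <- enum {: m.-tuple 'I_n.+1}]
     | is_intpart n m k].

Lemma mem_intparts (n m : nat) (k : seq nat) :
  (k \in intparts n m) = is_intpart n m k.
Proof.
rewrite mem_filter andb_idr // => /and4P[/eqP sk _ _ /eqP nk].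
have le_kn i : i \in k -> (i < n.+1)%N.
  rewrite ltnS -nk; elim: k {sk nk} => //= x k IH.
  rewrite inE => /predU1P[->|/IH le_ik]; first exact: leq_addr.
  exact: leq_trans le_ik (leq_addl _ _).
have st : size [seq inord i : 'I_n.+1 | i <- k] == m by rewrite size_map sk.
apply/mapP; exists (Tuple st); first by rewrite mem_enum.
rewrite /= -map_comp -[LHS]map_id; apply/eq_in_map => i /le_kn lt_in /=.
by rewrite inordK.
Qed.

Lemma uniq_intparts (n m : nat) : uniq (intparts n m).
Proof.
apply: filter_uniq; rewrite map_inj_uniq ?enum_uniq // => s t.
by move=> /(inj_map val_inj)/val_inj.
Qed.

(* Parts are indexed from 0: the j-th entry is the number of i with
   k_i >= j + 1, for j < k_1. *)
Definition conj_part (k : seq nat) : seq nat :=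
  [seq count (fun x => j < x)%N k | j <- iota 0 (head 0%N k)].

(* With parts indexed from 0, the weight i - 1 becomes i. *)
Definition a_part (k : seq nat) : nat :=
  (\sum_(0 <= i < size k) i * nth 0 k i)%N.

Definition eigenvalue_part (R : realType) (alpha : R) (n m : nat)
    (k : seq nat) : R :=
  n%:R * (m%:R - 1) + (a_part (conj_part k))%:R * alpha - (a_part k)%:R.

Definition eigenvalues (R : realType) (alpha : R) (n m : nat) : seq R :=
  [seq eigenvalue_part alpha n m k | k <- intparts n m].

Definition sample_mean (R : realType) (x : seq R) : R :=
  (size x)%:R^-1 * \sum_(y <- x) y.

Definition sample_variance (R : realType) (x : seq R) : R :=
  ((size x)%:R - 1)^-1 * \sum_(y <- x) (y - sample_mean x) ^+ 2.

(* Main.v *)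
Require Import Defs.
From mathcomp Require Import all_boot all_order all_algebra perm.
From mathcomp Require Import all_classical all_reals all_analysis.
From mathcomp Require Import zify ring lra.

Import Order.TTheory GRing.Theory Num.Theory.
Import numFieldNormedType.Exports.

Local Open Scope classical_set_scope.
Local Open Scope ring_scope.

(** The eigenvalue of a partition [k] of [n] into [m] parts is
    [alpha * binsum k] up to an error of size at most [m * n], where
    [binsum k], the sum of the binomials ['C(k_i, 2)], is [a] of the conjugate
    partition ([a_part_conj], [eigenvalue_part_dist]).  Scaled by [n ^ 2], the
    error is [O(1 / n)], so both limits reduce to the limits of the averages of
    [binsum k / n ^ 2] and of its square over the partitions.

    These averages are the same as over weak compositions, that is, ordered
    [m]-tuples of natural numbers with sum [n].  Indeed a composition with
    nonzero and pairwise distinct entries is the rearrangement of exactly one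
    partition by exactly one permutation ([weight_generic]), so [m`!] times a
    sum over partitions equals the sum over compositions, up to the
    contribution of the compositions with a zero or a repeated entry.  Among
    the order of [n ^ (m - 1)] compositions there are only [O(n ^ (m - 2))] of
    those ([exceptions_le]), which is negligible for bounded summands
    ([cvg_sum_intparts]).

    Over compositions the sums are explicit: splitting off the first entry and
    using the convolution identity for binomial coefficients
    ([bin_convolution_shift]), induction on [m] expresses the number of
    compositions and the sums of [binsum] and of its square through binomial
    coefficients ['C(n + m - 1, _)] ([sum1_tuples], [sum_binsum_tuples],
    [sum_binsum_sqr_tuples]).  Their leading terms give the first two moments
    of [binsum k / n ^ 2], namely
    [1 / (m + 1)] and [(m + 5) / ((m + 1) (m + 2) (m + 3))], which are those of
    half the sum of the squares of the coordinates of a uniform point of the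
    simplex.  The variance is then
    [alpha ^ 2] times the second moment minus the square of the first; the
    factor [r / (r - 1)] tends to 1 because the number [r] of partitions is of
    order [n ^ (m - 1)]. *)

(** * Sums of binomial coefficients over compositions *)

(** Vandermonde's identity in the upper index: choosing [a + b + 1] among
    [n + 1] points and splitting at the position of the [a + 1]-st one. *)
Lemma bin_convolution (n a b : nat) :
  (\sum_(k < n.+1) 'C(k, a) * 'C(n - k, b) = 'C(n.+1, (a + b).+1))%N.
Proof.
elim: n b => [|n IHn] [|b].
- by rewrite big_ord1 addn0 muln1 binS bin0n; case: a.
- by rewrite big_ord1 muln0 bin_small // addnS.
- rewrite big_ord_recr /= bin0 muln1 addn0.
  rewrite (eq_bigr (fun k : 'I_n.+1 => 'C(k, a) * 'C(n - k, 0))%N).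
    by rewrite IHn addn0 [RHS]binS.
  by move=> k _; rewrite !bin0.
- rewrite big_ord_recr /= subnn muln0 addn0.
  rewrite (eq_bigr (fun k : 'I_n.+1 =>
     'C(k, a) * 'C(n - k, b.+1) + 'C(k, a) * 'C(n - k, b))%N).
    by rewrite big_split /= !IHn addnS [RHS]binS.
  by move=> k _; rewrite subSn -1?ltnS // binS mulnDr.
Qed.

(** The case met when the first entry [k] of a composition of [n] is split
    off: the other entries contribute ['C(n - k + m, m + b)]. *)
Lemma bin_convolution_shift (n m a b : nat) :
  (\sum_(k < n.+1) 'C(k, a) * 'C(n - k + m, m + b)
   = 'C((n + m).+1, (m + (a + b)).+1))%N.
Proof.
rewrite [in RHS]addnCA -bin_convolution -addSn
  -(big_mkord xpredT (fun k => 'C(k, a) * 'C(n + m - k, m + b)))%N.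
rewrite (big_cat_nat _ (n := n.+1)) ?leq_addr //= big_mkord.
rewrite [X in _ = (_ + X)%N]big1_seq => [|k].
  by rewrite addn0; apply: eq_bigr => k _; rewrite addnBAC // -ltnS.
rewrite mem_index_iota => /and3P[_ lt_nk lt_k].
by rewrite ['C(_ - _, _)]bin_small ?muln0 //; lia.
Qed.

(** The entries are bounded by [N] rather than by the sum of the tuple, so that
    removing an entry, which lowers the sum, keeps the type of the others. *)
Definition vals {N m : nat} (t : m.-tuple 'I_N.+1) : seq nat := map val t.

Lemma sum_tuple_cons (N m n : nat) (F : seq nat -> nat) : (n <= N)%N ->
  (\sum_(t : m.+1.-tuple 'I_N.+1 | sumn (vals t) == n) F (vals t)
   = \sum_(k < n.+1)
       \sum_(t : m.-tuple 'I_N.+1 | sumn (vals t) == n - k)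
          F (nat_of_ord k :: vals t))%N.
Proof.
move=> le_nN.
rewrite (reindex (fun p : 'I_N.+1 * m.-tuple 'I_N.+1 => cons_tuple p.1 p.2)) /=;
  last first.
  exists (fun t => (thead t, behead_tuple t)) => [[x t] _|t _] /=.
    by rewrite theadE; congr pair; apply: val_inj.
  by apply: val_inj; case/tupleP: t.
rewrite -(pair_big_dep xpredT (fun (k : 'I_N.+1) (t : m.-tuple 'I_N.+1) =>
  k + sumn (vals t) == n) (fun k t => F (nat_of_ord k :: vals t)))%N /=.
rewrite (bigID (fun k : 'I_N.+1 => k < n.+1)%N) /= [X in (_ + X)%N]big1.
  rewrite addn0 (big_ord_widen_cond N.+1 xpredT (fun k =>
    \sum_(t : m.-tuple 'I_N.+1 | sumn (vals t) == n - k)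
          F (k :: vals t))%N) //=.
  by apply: eq_bigr => k lt_kn; apply: eq_bigl => t; lia.
by move=> k nlt; rewrite big1 // => t /eqP; lia.
Qed.

(** The weighted sum [a] of the conjugate partition, see [a_part_conj]; unlike
    that sum it is visibly symmetric in the entries. *)
Definition binsum (s : seq nat) : nat := (\sum_(x <- s) 'C(x, 2))%N.

Lemma sum_tuple1 (N n : nat) (F : seq nat -> nat) : (n <= N)%N ->
  (\sum_(t : 1.-tuple 'I_N.+1 | sumn (vals t) == n) F (vals t)
   = F [:: n])%N.
Proof.
move=> le_nN; rewrite sum_tuple_cons // big_ord_recr /= big1 => [|k _].
  rewrite subnn add0n (big_pred1 [tuple]) => [|t]; first by [].
  by rewrite [t]tuple0 [RHS]eqxx.
by rewrite big_pred0 // => t; rewrite tuple0 /=; have := ltn_ord k; lia.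
Qed.

Lemma binsum_cons (x : nat) (s : seq nat) :
  binsum (x :: s) = ('C(x, 2) + binsum s)%N.
Proof. exact: big_cons. Qed.

Lemma sum1_tuples (N m n : nat) : (n <= N)%N ->
  (\sum_(t : m.+1.-tuple 'I_N.+1 | sumn (vals t) == n) 1 = 'C(n + m, m))%N.
Proof.
elim: m n => [|m IHm] n le_nN.
  by rewrite (sum_tuple1 _ _ (fun=> 1%N)) // addn0 bin0.
rewrite (sum_tuple_cons _ _ _ (fun=> 1%N)) // addnS.
have := bin_convolution_shift n m 0 0; rewrite !addn0 => <-.
apply: eq_bigr => k _; rewrite IHm ?bin0 ?mul1n //.
exact: leq_trans (leq_subr _ _) le_nN.
Qed.

Lemma sum_binsum_tuples (N m n : nat) : (n <= N)%N ->
  (\sum_(t : m.+1.-tuple 'I_N.+1 | sumn (vals t) == n) binsum (vals t)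
   = m.+1 * 'C(n + m, m + 2))%N.
Proof.
elim: m n => [|m IHm] n le_nN.
  by rewrite sum_tuple1 // /binsum big_seq1 addn0 mul1n.
rewrite sum_tuple_cons //.
transitivity (\sum_(k < n.+1) ('C(k, 2) * 'C(n - k + m, m + 0)
                + m.+1 * ('C(k, 0) * 'C(n - k + m, m + 2))))%N.
  apply: eq_bigr => k _.
  have le_kN : (n - k <= N)%N by exact: leq_trans (leq_subr _ _) le_nN.
  under eq_bigr do rewrite binsum_cons -['C(_, _)]muln1.
  by rewrite big_split -big_distrr /= sum1_tuples // IHm // bin0 mul1n addn0.
rewrite big_split -big_distrr /= !bin_convolution_shift addn0 add0n.
by rewrite -mulSn [(n + m.+1)%N]addnS.
Qed.

Lemma bin2_sqr (k : nat) :
  ('C(k, 2) ^ 2 = 6 * 'C(k, 4) + 6 * 'C(k, 3) + 'C(k, 2))%N.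
Proof.
elim: k => // k IHk; rewrite [in LHS]binS sqrnD IHk !binS ?bin1 ?bin0.
have := mul_bin_left k 2; have := mul_bin_left k 1; rewrite bin1.
case: k {IHk} => [|[|k]] //; rewrite !subSS !subn0.
by move: 'C(k.+2, 2) 'C(k.+2, 3) 'C(k.+2, 4) => x y z; nia.
Qed.

(** Expanding the square of ['C(k, 2) + binsum s] needs the square of a
    binomial coefficient in the binomial basis, [bin2_sqr], and both preceding
    sums. *)
Lemma sum_binsum_sqr_tuples (N m n : nat) : (n <= N)%N ->
  (\sum_(t : m.+1.-tuple 'I_N.+1 | sumn (vals t) == n)
     binsum (vals t) ^ 2
   = m.+1 * (m + 6) * 'C(n + m, m + 4) + 6 * m.+1 * 'C(n + m, m + 3)
     + m.+1 * 'C(n + m, m + 2))%N.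
Proof.
elim: m n => [|m IHm] n le_nN.
  rewrite (sum_tuple1 _ _ (fun s => binsum s ^ 2)%N) // /binsum big_seq1 addn0.
  by rewrite bin2_sqr !mul1n.
rewrite (sum_tuple_cons _ _ _ (fun s => binsum s ^ 2)%N) //.
transitivity (\sum_(k < n.+1) (
    6 * ('C(k, 4) * 'C(n - k + m, m + 0))
  + 6 * ('C(k, 3) * 'C(n - k + m, m + 0))
  + 'C(k, 2) * 'C(n - k + m, m + 0)
  + 2 * m.+1 * ('C(k, 2) * 'C(n - k + m, m + 2))
  + m.+1 * (m + 6) * ('C(k, 0) * 'C(n - k + m, m + 4))
  + 6 * m.+1 * ('C(k, 0) * 'C(n - k + m, m + 3))
  + m.+1 * ('C(k, 0) * 'C(n - k + m, m + 2))))%N.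
  apply: eq_bigr => k _.
  have le_kN : (n - k <= N)%N by exact: leq_trans (leq_subr _ _) le_nN.
  transitivity ('C(k, 2) ^ 2 * 'C(n - k + m, m)
     + 2 * 'C(k, 2) * (m.+1 * 'C(n - k + m, m + 2))
     + \sum_(t : m.+1.-tuple 'I_N.+1 | sumn (vals t) == n - k)
         binsum (vals t) ^ 2)%N; last first.
    by rewrite IHm // bin2_sqr bin0 addn0; lia.
  rewrite -(sum1_tuples N) // -(sum_binsum_tuples N) // !big_distrr /=.
  rewrite -!big_split /=; apply: eq_bigr => t _.
  by rewrite binsum_cons sqrnD; lia.
(* Exactly six splittings: a further one would see the multiplication by 6 as
   an iterated addition. *)
do 6 rewrite big_split /=.
rewrite -!big_distrr /= !bin_convolution_shift !addn0 !add0n -[(2 + 2)%N]/4%N.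
rewrite [(n + m.+1)%N]addnS -!addSn; move: 'C(_, _) 'C(_, _) 'C(_, _) => x y z.
lia.
Qed.

(** * From compositions to partitions *)

Definition permute_tuple {T : Type} {m : nat} (s : 'S_m) (t : m.-tuple T) :
  m.-tuple T := [tuple tnth t (s i) | i < m].

Lemma permute_tuple_bij (T : Type) (m : nat) (s : 'S_m) :
  bijective (@permute_tuple T m s).
Proof.
exists (permute_tuple s^-1%g) => t; apply: eq_from_tnth => i.
  by rewrite !tnth_mktuple permKV.
by rewrite !tnth_mktuple permK.
Qed.

Lemma perm_vals_permute (N m : nat) (s : 'S_m) (t : m.-tuple 'I_N.+1) :
  perm_eq (vals (permute_tuple s t)) (vals t).
Proof. by apply: perm_map; apply/tuple_permP; exists s. Qed.

Lemma sumn_vals (N m : nat) (t : m.-tuple 'I_N.+1) :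
  sumn (vals t) = (\sum_(i < m) tnth t i)%N.
Proof. by rewrite sumnE big_map big_tuple. Qed.

Lemma sum_intparts (V : nmodType) (n m : nat) (G : seq nat -> V) :
  \sum_(k <- intparts n m) G k =
  \sum_(t : m.-tuple 'I_n.+1 | is_intpart n m (vals t)) G (vals t).
Proof. by rewrite big_filter big_map big_enum_cond. Qed.

Definition generic (s : seq nat) : bool := uniq s && all (leq 1) s.

(** How often a tuple arises by permuting the entries of a partition. *)
Definition weight {n m : nat} (t : m.-tuple 'I_n.+1) : nat :=
  (\sum_(s : 'S_m | is_intpart n m (vals (permute_tuple s t))) 1)%N.

(** Sorting shows that some permutation works; two of them produce the same
    sorted list, so they agree because the entries are distinct. *)
Lemma weight_generic (n m : nat) (t : m.-tuple 'I_n.+1) :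
  sumn (vals t) == n -> generic (vals t) -> weight t = 1%N.
Proof.
move=> sum_t /andP[uniq_t pos_t].
have geT : total (fun x y : 'I_n.+1 => geq x y).
  by move=> x y; exact: leq_total.
have /tuple_permP[s0 Es0] : perm_eq (sort (fun x y : 'I_n.+1 => geq x y) t) t.
  by rewrite perm_sort.
have part_s0 : is_intpart n m (vals (permute_tuple s0 t)).
  apply/and4P; split.
  - by rewrite size_map size_tuple.
  - by rewrite /vals -Es0 sorted_map; exact: sort_sorted.
  - by rewrite (perm_all _ (perm_vals_permute _ _ _ _)).
  - by rewrite (perm_sumn (perm_vals_permute _ _ _ _)).
rewrite /weight (big_pred1 s0) // => s; apply/idP/eqP => [part_s|->//].
have inj_t : injective (tnth t).
  by apply/tuple_uniqP; rewrite -(map_inj_uniq val_inj).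
have eq_vals : vals (permute_tuple s t) = vals (permute_tuple s0 t).
  have [/and4P[_ srt _ _] /and4P[_ srt0 _ _]] := (part_s, part_s0).
  apply: (sorted_eq _ _ srt srt0).
  - by move=> y x z /= le_yx le_zy; exact: leq_trans le_zy le_yx.
  - by move=> x y /= /andP[le_yx le_xy]; apply/eqP; rewrite eqn_leq le_xy.
  - apply: (perm_trans (perm_vals_permute _ _ _ _)).
    by rewrite perm_sym perm_vals_permute.
apply/permP => i; apply: inj_t.
have /val_inj/(congr1 (fun u => tnth u i)) := inj_map val_inj eq_vals.
by rewrite !tnth_mktuple.
Qed.

Lemma weight_le (n m : nat) (t : m.-tuple 'I_n.+1) : (weight t <= m`!)%N.
Proof. by rewrite /weight sum1_card -card_Sn max_card. Qed.

(** Summing over all permutations on the left, and exchanging the sums after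
    reindexing by each permutation, counts each tuple [weight] times. *)
Lemma fact_sum_intparts (R : numDomainType) (n m : nat) (G : seq nat -> R) :
  (forall s s', perm_eq s s' -> G s = G s') ->
  m`!%:R * \sum_(k <- intparts n m) G k =
  \sum_(t : m.-tuple 'I_n.+1 | sumn (vals t) == n)
     (weight t)%:R * G (vals t).
Proof.
move=> symG; rewrite sum_intparts -card_Sn -sum1_card natr_sum mulr_suml.
under eq_bigr => s _.
  rewrite mul1r (reindex _ (onW_bij _ (permute_tuple_bij _ _ s))) /=.
  under eq_bigr => t _ do rewrite (symG _ _ (perm_vals_permute _ _ s t)).
  over.
rewrite (exchange_big_dep (fun t : m.-tuple 'I_n.+1 => sumn (vals t) == n)) /=.
  apply: eq_bigr => t _; rewrite natr_sum mulr_suml.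
  by under [RHS]eq_bigr do rewrite mul1r.
move=> s t _ /and4P[_ _ _].
by rewrite (perm_sumn (perm_vals_permute _ _ _ _)).
Qed.

Definition exceptions (n m : nat) : nat :=
  (\sum_(t : m.-tuple 'I_n.+1 |
       (sumn (vals t) == n) && ~~ generic (vals t)) 1)%N.

(** The weight is 1 except on the exceptional tuples, where it differs from 1
    by at most [m`!]. *)
Lemma dist_sum_intparts (R : realDomainType) (n m : nat) (G : seq nat -> R)
    (B : R) :
  (forall s s', perm_eq s s' -> G s = G s') ->
  (forall s, sumn s = n -> `|G s| <= B) ->
  `|m`!%:R * \sum_(k <- intparts n m) G k -
    \sum_(t : m.-tuple 'I_n.+1 | sumn (vals t) == n) G (vals t)|
  <= B * (m`! * exceptions n m)%:R.
Proof.
move=> symG leGB; rewrite fact_sum_intparts // -sumrB.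
rewrite (bigID (fun t : m.-tuple 'I_n.+1 => generic (vals t))) /=.
rewrite big1 ?add0r; last first.
  by move=> t /andP[sum_t gen_t]; rewrite weight_generic // mul1r subrr.
apply: (le_trans (ler_norm_sum _ _ _)).
rewrite natrM /exceptions natr_sum !mulr_sumr.
apply: ler_sum => t /andP[sum_t _].
rewrite mulr1 -{2}[G _]mul1r -mulrBl normrM mulrC.
apply: ler_pM => //; first by apply: leGB; apply/eqP.
rewrite ler_norml; apply/andP; split.
  rewrite lerBrDl (le_trans _ (ler0n _ _)) // subr_le0 ler1n fact_gt0.
rewrite lerBlDr (le_trans (y := m`!%:R)) ?ler_nat ?weight_le //.
by rewrite lerDl ler01.
Qed.

(** The tuples whose entries at [i] and [j] satisfy one more linear relation:
    the first of them is zero if the boolean is true, and they are equal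
    otherwise. *)
Definition coincidence (n : nat) {m : nat} (q : bool * ('I_m * 'I_m))
    (t : m.-tuple 'I_n.+1) : bool :=
  [&& sumn (vals t) == n, q.2.1 != q.2.2 &
      if q.1 then tnth t q.2.1 == ord0 else tnth t q.2.1 == tnth t q.2.2].

(** The sum and the additional relation determine the entries at [i] and [j]
    from the [m - 2] others. *)
Lemma card_coincidence (n m : nat) (q : bool * ('I_m * 'I_m)) :
  (#|coincidence n q| <= n.+1 ^ (m - 2))%N.
Proof.
case: q => b [i j]; have [ij|neq_ij] := boolP (i != j); last first.
  rewrite (eq_card0 (A := coincidence n _)) // => t.
  by rewrite unfold_in /coincidence /= (negPf neq_ij) andbF.
(* Erasing the entries at i and j is injective on the set to be counted. *)
pose f (t : m.-tuple 'I_n.+1) : {ffun 'I_m -> 'I_n.+1} :=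
  [ffun l => if l \in pred2 i j then ord0 else tnth t l].
have inj_f : {in coincidence n (b, (i, j)) &, injective f}.
  move=> t u; rewrite !unfold_in /coincidence /= !sumn_vals.
  move=> /and3P[/eqP sum_t _ eq_t] /and3P[/eqP sum_u _ eq_u] /ffunP eq_f.
  have out l : l != i -> l != j -> tnth t l = tnth u l.
    move=> li lj; have := eq_f l; rewrite !ffunE inE.
    by rewrite (negPf li) (negPf lj).
  move: sum_t; rewrite -[in RHS]sum_u (bigD1 i) //= (bigD1 j) 1?eq_sym //=.
  rewrite [in RHS](bigD1 i) //= [in X in _ = (_ + X)%N](bigD1 j) 1?eq_sym //=.
  rewrite (eq_bigr (fun l => nat_of_ord (tnth u l))); last first.
    by move=> l /andP[li lj]; rewrite out.
  rewrite !addnA => /addIn sum_ij.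
  have [eq_i eq_j] : tnth t i = tnth u i /\ tnth t j = tnth u j.
    case: b eq_t eq_u => /= /eqP eq_t /eqP eq_u; split; apply: val_inj;
      move: sum_ij; rewrite ?eq_t ?eq_u /=; lia.
  apply: eq_from_tnth => l.
  by have [->//|li] := eqVneq l i; have [->//|lj] := eqVneq l j; exact: out.
rewrite -(card_in_image inj_f).
have <- : #|[predC pred2 i j]| = (m - 2)%N.
  have := cardC (pred2 i j); rewrite card2 ij card_ord.
  by move=> /(congr1 (subn^~ 2%N)); rewrite addKn.
have := card_pffun_on (ord0 : 'I_n.+1) [predC pred2 i j] predT.
rewrite card_ord => <-.
apply: subset_leq_card; apply/fintype.subsetP => g /fintype.imageP[t _ ->].
apply/pffun_onP; split=> [|//]; apply/fintype.subsetP => l.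
by rewrite !inE ffunE inE; case: ifP => //; rewrite eqxx.
Qed.

(** A zero entry is a coincidence with any other index, which exists because
    [m >= 2], so every exceptional tuple satisfies one of the [2 * m ^ 2]
    coincidences. *)
Lemma exceptions_le (n m : nat) : (2 <= m)%N ->
  (exceptions n m <= 2 * (m * m) * n.+1 ^ (m - 2))%N.
Proof.
move=> m_ge2.
have -> : (2 * (m * m) = #|{: bool * ('I_m * 'I_m)}|)%N.
  by rewrite !card_prod card_bool card_ord.
rewrite -sum_nat_const.
apply: (leq_trans _ (leq_sum _ (fun q _ => card_coincidence n m q))) => //.
under [leqRHS]eq_bigr do rewrite -sum1_card.
rewrite (exchange_big_dep xpredT) //= /exceptions big_mkcond /=.
apply: leq_sum => t _; case: ifP => // /andP[sum_t].
apply: contraNT; rewrite -ltnNge ltnS leqn0 sum_nat_eq0 => /forallP no_q.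
have noq q : ~~ coincidence n q t by have := no_q q; rewrite implybF.
apply/andP; split.
  rewrite (map_inj_uniq val_inj); apply/tuple_uniqP => i j eq_ij.
  apply/eqP; apply: contraT => ij; have := noq (false, (i, j)).
  by rewrite /coincidence sum_t /= ij eq_ij eqxx.
apply/allP => _ /mapP[_ /tnthP[i ->] ->]; rewrite lt0n; apply/eqP => ti0.
have [j ij] : exists j, i != j.
  have [i0|i0] := eqVneq i (Ordinal (ltnW m_ge2)).
    by exists (Ordinal m_ge2); rewrite i0.
  by exists (Ordinal (ltnW m_ge2)).
have := noq (true, (i, j)); rewrite /coincidence sum_t /= ij /=.
by rewrite -val_eqE /= ti0.
Qed.

(** * The eigenvalue of a partition *)

(** Exchanging the sums, each part [x] contributes the sum of the [i < x]. *)
Lemma a_part_conj (n m : nat) (k : seq nat) :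
  is_intpart n m k -> a_part (conj_part k) = binsum k.
Proof.
move=> /and4P[_ srt _ _].
have le_head x : x \in k -> (x <= head 0%N k)%N.
  case: k srt => //= y k /(order_path_min _) /allP min_y.
  rewrite inE => /predU1P[->//|/min_y]; apply.
  by move=> u v w /= le_uv le_wu; exact: leq_trans le_wu le_uv.
rewrite /a_part /conj_part size_map size_iota.
(* The i-th entry of the conjugate counts the parts larger than i. *)
transitivity (\sum_(0 <= i < head 0 k) \sum_(x <- k) i * (i < x))%N.
  apply: eq_big_nat => i /andP[_ lt_i].
  rewrite (nth_map 0%N) ?size_iota // nth_iota // add0n -big_distrr /=.
  by rewrite -sum1_count big_mkcond.
rewrite exchange_big /= /binsum; apply: eq_big_seq => x /le_head le_x.
rewrite -bin2_sum (big_cat_nat _ (n := x)) //= [X in (_ + X)%N]big_nat_cond.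
rewrite [X in (_ + X)%N]big1 => [|i].
  rewrite addn0; apply: eq_big_nat => i /andP[_ ->]; exact: muln1.
by case/andP => /andP[le_xi _] _; rewrite ltnNge le_xi muln0.
Qed.

Lemma a_part_le (k : seq nat) : (a_part k <= (size k).-1 * sumn k)%N.
Proof.
rewrite /a_part sumnE [X in (_ <= _ * X)%N](big_nth 0%N) big_distrr /=.
rewrite big_nat_cond [leqRHS]big_nat_cond; apply: leq_sum => i.
rewrite andbT => /andP[_ lt_i]; rewrite leq_mul2r; apply/orP; right.
by rewrite -ltnS (ltn_predK lt_i).
Qed.

Lemma binsum_le (s : seq nat) : (binsum s <= sumn s ^ 2)%N.
Proof.
elim: s => [|x s IHs]; first by rewrite /binsum big_nil.
rewrite binsum_cons /= sqrnD (leq_trans _ (leq_addr _ _)) //.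
by apply: leq_add => //; rewrite bin2; case: x => //= x; lia.
Qed.

(** The two other terms of the eigenvalue, [n * (m - 1)] and [a_part k], both
    lie between 0 and [(m - 1) * n]. *)
Lemma eigenvalue_part_dist (R : realType) (alpha : R) (n m : nat)
    (k : seq nat) :
  (0 < m)%N -> is_intpart n m k ->
  `|eigenvalue_part alpha n m k - alpha * (binsum k)%:R| <= m%:R * n%:R.
Proof.
case: m => // m _ part_k; rewrite /eigenvalue_part (a_part_conj _ _ _ part_k).
case/and4P: part_k => /eqP sz _ _ /eqP sm.
have := a_part_le k; rewrite sz sm -(ler_nat R) natrM /= => le_a.
have n0 : 0 <= n%:R :> R by [].
have a0 : 0 <= (a_part k)%:R :> R by [].
have mn0 : 0 <= m%:R * n%:R :> R by rewrite mulr_ge0.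
by rewrite -[m.+1%:R]natr1 ler_norml; apply/andP; split; lra.
Qed.

(** * Asymptotics of sums over partitions *)

Lemma sumr_const_seq (V : nmodType) (I : Type) (r : seq I) (x : V) :
  \sum_(i <- r) x = x *+ size r.
Proof. by rewrite big_const_seq count_predT iter_addr_0. Qed.

Lemma cvgn_eq (R : realType) (f : nat -> R) (l l' : R) :
  l = l' -> f @ \oo --> l -> f @ \oo --> l'.
Proof. by move=> ->. Qed.

Lemma cvg_invn (R : realType) : (fun n : nat => n%:R^-1 : R) @ \oo --> (0 : R).
Proof. by rewrite -cvg_shiftS; exact: cvg_harmonic. Qed.

Lemma cvg_addn_div (R : realType) (c : R) :
  (fun n : nat => (n%:R + c) / n%:R) @ \oo --> (1 : R).
Proof.
apply: (@cvg_trans _ ((fun n : nat => 1 + c * n%:R^-1) @ \oo)).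
  apply: near_eq_cvg; near=> n.
  rewrite mulrDl divff // pnatr_eq0 -lt0n.
  by near: n; exact: nbhs_infty_gt.
apply: (cvgn_eq _ _ (1 + c * 0)); first by rewrite mulr0 addr0.
apply: cvgD; first exact: cvg_cst.
by apply: cvgM; [exact: cvg_cst|exact: cvg_invn].
Unshelve. all: by end_near. Qed.

Lemma cvg_bin (R : realType) (c k : nat) :
  (fun n : nat => 'C(n + c, k)%:R / n%:R ^+ k) @ \oo --> (k`!%:R^-1 : R).
Proof.
elim: k => [|k IHk].
  under eq_fun do rewrite bin0 expr0 divr1.
  by rewrite fact0 invr1; exact: cvg_cst.
have -> : (fun n : nat => 'C(n + c, k.+1)%:R / n%:R ^+ k.+1 : R) =
  (fun n : nat => 'C(n + c, k)%:R / n%:R ^+ k *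
     ((n%:R + (c%:R - k%:R)) / n%:R) * k.+1%:R^-1).
  apply/funext => n.
  have -> : 'C(n + c, k.+1)%:R =
    'C(n + c, k)%:R * (n%:R + (c%:R - k%:R)) / k.+1%:R :> R.
    apply: (canRL (mulfK _)); first by rewrite pnatr_eq0.
    rewrite -natrM mulnC mul_bin_left.
    have [lt_k|le_k] := ltnP (n + c) k.
      by rewrite bin_small // muln0 mul0r.
    by rewrite natrM natrB // natrD mulrC addrA.
  by rewrite exprS invfM; ring.
apply: (cvgn_eq _ _ (k`!%:R^-1 * 1 * k.+1%:R^-1)).
  by rewrite mulr1 factS natrM invfM mulrC.
by apply: cvgM; [apply: cvgM; [exact: IHk|exact: cvg_addn_div]|exact: cvg_cst].
Qed.

Lemma cvg_exceptions (R : realType) (m : nat) : (2 <= m)%N ->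
  (fun n : nat => (exceptions n m)%:R / n%:R ^+ m.-1) @ \oo --> (0 : R).
Proof.
case: m => [|[|m]] // _.
apply: (@squeeze_cvgr _ _ _ _ (fun=> 0) (fun n : nat =>
   (2 * (m.+2 * m.+2))%:R * (((n%:R + 1) / n%:R) ^+ m * n%:R^-1))).
- apply: nearW => n; rewrite divr_ge0 ?exprn_ge0 //=.
  have -> : (2 * (m.+2 * m.+2))%:R * (((n%:R + 1) / n%:R) ^+ m * n%:R^-1) =
     (2 * (m.+2 * m.+2) * n.+1 ^ (m.+2 - 2))%:R / n%:R ^+ m.+1 :> R.
    by rewrite subn2 [in RHS]natrM natrX -natr1 expr_div_n exprSr invfM; ring.
  by rewrite ler_wpM2r ?invr_ge0 ?exprn_ge0 // ler_nat exceptions_le.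
- exact: cvg_cst.
- apply: (cvgn_eq _ _ ((2 * (m.+2 * m.+2))%:R * (1 ^+ m * 0))).
    by rewrite !mulr0.
  apply: cvgM; first exact: cvg_cst.
  apply: cvgM; last exact: cvg_invn.
  elim: m => [|m IHm]; first by under eq_fun do rewrite expr0; exact: cvg_cst.
  under eq_fun do rewrite exprS; rewrite exprS.
  by apply: cvgM => //; exact: cvg_addn_div.
Qed.

(** The exceptional tuples are [O(n ^ (m - 2))] in number, hence negligible
    for bounded summands. *)
Lemma cvg_sum_intparts (R : realType) (m : nat) (g : nat -> seq nat -> R)
    (B l : R) : (2 <= m)%N ->
  (forall n s s', perm_eq s s' -> g n s = g n s') ->
  (forall n s, sumn s = n -> `|g n s| <= B) ->
  (fun n : nat => (\sum_(t : m.-tuple 'I_n.+1 | sumn (vals t) == n)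
      g n (vals t)) / n%:R ^+ m.-1) @ \oo --> l ->
  (fun n : nat => (\sum_(k <- intparts n m) g n k) / n%:R ^+ m.-1) @ \oo -->
    l / m`!%:R.
Proof.
move=> m_ge2 symg leB cvg_l.
have fact0 : m`!%:R != 0 :> R by rewrite pnatr_eq0 -lt0n fact_gt0.
set P := fun n : nat => \sum_(k <- intparts n m) g n k.
set C := fun n : nat => \sum_(t : m.-tuple 'I_n.+1 | sumn (vals t) == n)
   g n (vals t) in cvg_l *.
have cvg_diff : (fun n : nat => (m`!%:R * P n - C n) / n%:R ^+ m.-1) @ \oo -->
    (0 : R).
  apply/norm_cvg0P.
  apply: (@squeeze_cvgr _ _ _ _ (fun=> 0) (fun n : nat =>
     B * m`!%:R * ((exceptions n m)%:R / n%:R ^+ m.-1))).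
  - apply: nearW => n; rewrite normr_ge0 /= normrM.
    rewrite [`|_^-1|]ger0_norm ?invr_ge0 ?exprn_ge0 //.
    rewrite mulrA ler_wpM2r ?invr_ge0 ?exprn_ge0 //.
    rewrite -mulrA -natrM; apply: dist_sum_intparts; [exact: symg|exact: leB].
  - exact: cvg_cst.
  - apply: (cvgn_eq _ _ (B * m`!%:R * 0)); first by rewrite mulr0.
    by apply: cvgM; [exact: cvg_cst|exact: cvg_exceptions].
have -> : (fun n : nat => P n / n%:R ^+ m.-1) =
   (fun n : nat => ((m`!%:R * P n - C n) / n%:R ^+ m.-1 + C n / n%:R ^+ m.-1)
      * m`!%:R^-1).
  by apply/funext => n; rewrite -mulrDl subrK mulrAC [_ * P n]mulrC mulfK.
apply: (cvgn_eq _ _ ((0 + l) * m`!%:R^-1)); first by rewrite add0r.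
apply: cvgM; last exact: cvg_cst.
exact: cvgD.
Qed.

(** * Limits of averages over partitions *)

Definition partition_avg (R : realType) (n m : nat) (f : seq nat -> R) : R :=
  (size (intparts n m))%:R^-1 * \sum_(k <- intparts n m) f k.

Lemma binsum_scaled_le1 (R : realType) (n : nat) (s : seq nat) :
  sumn s = n -> 0 <= ((binsum s)%:R / n%:R ^+ 2 : R) <= 1.
Proof.
move=> sum_s; rewrite divr_ge0 ?exprn_ge0 //=.
have := binsum_le s; rewrite sum_s -(ler_nat R) natrX.
case: n {sum_s} => [|n] le_s; first by rewrite expr0n /= invr0 mulr0.
by rewrite ler_pdivrMr ?mul1r // exprn_gt0 // ltr0n.
Qed.

Lemma perm_binsum (s s' : seq nat) : perm_eq s s' -> binsum s = binsum s'.
Proof. exact: perm_big. Qed.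

Lemma cvg_size_intparts (R : realType) (M : nat) : (0 < M)%N ->
  (fun n : nat => (size (intparts n M.+1))%:R / n%:R ^+ M) @ \oo -->
    (M`!%:R^-1 / M.+1`!%:R : R).
Proof.
move=> M_gt0.
have : (fun n : nat => (\sum_(k <- intparts n M.+1) 1) / n%:R ^+ M) @ \oo -->
    (M`!%:R^-1 / M.+1`!%:R : R).
  apply: (cvg_sum_intparts R M.+1 (fun _ _ => 1) 1) => //.
    by move=> n s _; rewrite normr1.
  have -> : (fun n : nat =>
      (\sum_(t : M.+1.-tuple 'I_n.+1 | sumn (vals t) == n) 1) / n%:R ^+ M) =
      (fun n : nat => 'C(n + M, M)%:R / n%:R ^+ M : R).
    apply/funext => n; rewrite -(sum1_tuples n M n) // natr_sum.
    by congr (_ / _).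
  exact: cvg_bin.
by under eq_fun do rewrite sumr_const_seq.
Qed.

Lemma cvg_inv_size_intparts (R : realType) (M : nat) : (0 < M)%N ->
  (fun n : nat => (size (intparts n M.+1))%:R^-1) @ \oo --> (0 : R).
Proof.
move=> M_gt0; have := cvg_size_intparts R M M_gt0.
set l := _ / _ => cvg_r.
have l0 : l != 0.
  by rewrite mulf_neq0 ?invr_eq0 ?pnatr_eq0 -?lt0n ?fact_gt0.
have cvg_invX : (fun n : nat => (n%:R ^+ M)^-1) @ \oo --> (0 : R).
  case: M M_gt0 {cvg_r l l0} => // M _.
  elim: M => [|M IHM]; first exact: cvg_invn.
  under eq_fun do rewrite exprS invfM.
  apply: (cvgn_eq _ _ (0 * 0)); first by rewrite mulr0.
  by apply: cvgM => //; exact: cvg_invn.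
apply: (@cvg_trans _ ((fun n : nat =>
    ((size (intparts n M.+1))%:R / n%:R ^+ M)^-1 * (n%:R ^+ M)^-1) @ \oo)).
  apply: near_eq_cvg; near=> n.
  rewrite invfM invrK mulfK // expf_neq0 // pnatr_eq0 -lt0n.
  by near: n; exact: nbhs_infty_gt.
apply: (cvgn_eq _ _ (l^-1 * 0)); first by rewrite mulr0.
by apply: cvgM => //; exact: cvgV.
Unshelve. all: by end_near. Qed.

(** The factors [M.+1`!] and [n ^ M] cancel in the quotient of a sum over
    partitions by their number; what remains is normalised by the limit
    [1 / M`!] of the number of compositions into [M.+1] entries over [n ^ M]. *)
Lemma cvg_partition_avg (R : realType) (M : nat) (g : nat -> seq nat -> R)
    (B l : R) : (0 < M)%N ->
  (forall n s s', perm_eq s s' -> g n s = g n s') ->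
  (forall n s, sumn s = n -> `|g n s| <= B) ->
  (fun n : nat => (\sum_(t : M.+1.-tuple 'I_n.+1 | sumn (vals t) == n)
      g n (vals t)) / n%:R ^+ M) @ \oo --> l ->
  (fun n : nat => partition_avg R n M.+1 (g n)) @ \oo --> l * M`!%:R.
Proof.
move=> M_gt0 symg leB cvg_l.
have cvg_P := cvg_sum_intparts R M.+1 g B l M_gt0 symg leB cvg_l.
have cvg_r := cvg_size_intparts R M M_gt0.
have M0 : M`!%:R != 0 :> R by rewrite pnatr_eq0 -lt0n fact_gt0.
have M10 : M.+1`!%:R != 0 :> R by rewrite pnatr_eq0 -lt0n fact_gt0.
apply: (@cvg_trans _ ((fun n : nat =>
    ((size (intparts n M.+1))%:R / n%:R ^+ M)^-1 *
    ((\sum_(k <- intparts n M.+1) g n k) / n%:R ^+ M)) @ \oo)).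
  apply: near_eq_cvg; near=> n.
  have n0 : n%:R ^+ M != 0 :> R.
    rewrite expf_neq0 // pnatr_eq0 -lt0n.
    by near: n; exact: nbhs_infty_gt.
  by rewrite /partition_avg invfM invrK mulrACA divff ?mulr1.
apply: (cvgn_eq _ _ ((M`!%:R^-1 / M.+1`!%:R)^-1 * (l / M.+1`!%:R))).
  by rewrite invfM !invrK; field.
by apply: cvgM => //; apply: cvgV => //; rewrite mulf_neq0 ?invr_eq0.
Unshelve. all: by end_near. Qed.

Lemma cvg_avg_binsum (R : realType) (M : nat) : (0 < M)%N ->
  (fun n : nat => partition_avg R n M.+1 (fun k => (binsum k)%:R / n%:R ^+ 2))
    @ \oo --> ((M%:R + 2)^-1 : R).
Proof.
move=> M_gt0.
have fM0 : M`!%:R != 0 :> R by rewrite pnatr_eq0 -lt0n fact_gt0.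
have M0 : 0 <= M%:R :> R by [].
apply: (cvgn_eq _ _ (M.+1%:R * (M + 2)`!%:R^-1 * M`!%:R)).
  rewrite addn2 !factS !natrM -!natr1 -addrA (_ : 1 + 1 = 2) //.
  by field; rewrite fM0 !lt0r_neq0 //; lra.
apply: (cvg_partition_avg R M _ 1) => //.
- by move=> n s s' /perm_binsum ->.
- move=> n s /(binsum_scaled_le1 R)/andP[s_ge0 s_le1].
  by rewrite ger0_norm.
have -> : (fun n : nat => (\sum_(t : M.+1.-tuple 'I_n.+1 | sumn (vals t) == n)
      (binsum (vals t))%:R / n%:R ^+ 2) / n%:R ^+ M) =
   (fun n : nat => M.+1%:R * ('C(n + M, M + 2)%:R / n%:R ^+ (M + 2)) : R).
  apply/funext => n.
  rewrite -mulr_suml -natr_sum sum_binsum_tuples // natrM -!exprVn exprD.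
  by ring.
by apply: cvgM; [exact: cvg_cst|exact: cvg_bin].
Qed.

(** Only the binomial coefficient of degree [M + 4] survives the division by
    [n ^ (M + 4)]; the two others leave powers of [1 / n]. *)
Lemma cvg_avg_binsum_sqr (R : realType) (M : nat) : (0 < M)%N ->
  (fun n : nat =>
     partition_avg R n M.+1 (fun k => ((binsum k)%:R / n%:R ^+ 2) ^+ 2))
    @ \oo --> ((M%:R + 6) / ((M%:R + 2) * (M%:R + 3) * (M%:R + 4)) : R).
Proof.
move=> M_gt0.
have fM0 : M`!%:R != 0 :> R by rewrite pnatr_eq0 -lt0n fact_gt0.
have M0 : 0 <= M%:R :> R by [].
apply: (cvgn_eq _ _ (((M.+1 * (M + 6))%:R * (M + 4)`!%:R^-1
   + ((6 * M.+1)%:R * (M + 3)`!%:R^-1 * 0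
   + M.+1%:R * (M + 2)`!%:R^-1 * (0 * 0))) * M`!%:R)).
  rewrite !mulr0 !addr0 !addnS !addn0 !factS !natrM -!natr1.
  by field; rewrite fM0 !lt0r_neq0 //; lra.
apply: (cvg_partition_avg R M _ 1) => //.
- by move=> n s s' /perm_binsum ->.
- move=> n s /(binsum_scaled_le1 R)/andP[s_ge0 s_le1].
  by rewrite ger0_norm ?exprn_ge0 // exprn_ile1.
have -> : (fun n : nat => (\sum_(t : M.+1.-tuple 'I_n.+1 | sumn (vals t) == n)
      ((binsum (vals t))%:R / n%:R ^+ 2) ^+ 2) / n%:R ^+ M) =
   (fun n : nat =>
      (M.+1 * (M + 6))%:R * ('C(n + M, M + 4)%:R / n%:R ^+ (M + 4)) +
      ((6 * M.+1)%:R * ('C(n + M, M + 3)%:R / n%:R ^+ (M + 3)) * n%:R^-1 +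
       M.+1%:R * ('C(n + M, M + 2)%:R / n%:R ^+ (M + 2)) *
         (n%:R^-1 * n%:R^-1)) : R).
  apply/funext => n.
  under eq_bigr do rewrite expr_div_n -[X in X / _]natrX.
  rewrite -mulr_suml -natr_sum sum_binsum_sqr_tuples //.
  rewrite -!exprVn !exprD.
  by ring.
apply: cvgD; first by apply: cvgM; [exact: cvg_cst|exact: cvg_bin].
apply: cvgD; apply: cvgM.
- by apply: cvgM; [exact: cvg_cst|exact: cvg_bin].
- exact: cvg_invn.
- by apply: cvgM; [exact: cvg_cst|exact: cvg_bin].
- by apply: cvgM; exact: cvg_invn.
Qed.

Lemma cvg_partition_avg_close (R : realType) (m : nat)
    (f h : nat -> seq nat -> R) (e : nat -> R) (l : R) :
  (forall n, 0 <= e n) -> e @ \oo --> (0 : R) ->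
  (forall n k, is_intpart n m k -> `|f n k - h n k| <= e n) ->
  (fun n : nat => partition_avg R n m (h n)) @ \oo --> l ->
  (fun n : nat => partition_avg R n m (f n)) @ \oo --> l.
Proof.
move=> e_ge0 cvg_e close cvg_h.
have cvg_diff : (fun n : nat =>
    partition_avg R n m (f n) - partition_avg R n m (h n)) @ \oo --> (0 : R).
  apply/norm_cvg0P; apply: (@squeeze_cvgr _ _ _ _ (fun=> 0) e) => //.
    apply: nearW => n; rewrite normr_ge0 /= /partition_avg -mulrBr -sumrB.
    rewrite normrM ger0_norm ?invr_ge0 //.
    have le_sum : `|\sum_(k <- intparts n m) (f n k - h n k)| <=
        (size (intparts n m))%:R * e n.
      apply: (le_trans (ler_norm_sum _ _ _)).
      rewrite mulr_natl -sumr_const_seq big_seq [leRHS]big_seq.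
      apply: ler_sum => k; rewrite mem_intparts; exact: close.
    apply: (le_trans (ler_wpM2l _ le_sum)); first by rewrite invr_ge0.
    have [->|r0] := eqVneq (size (intparts n m))%:R (0 : R).
      by rewrite mul0r mulr0.
    by rewrite mulKf.
  exact: cvg_cst.
have -> : (fun n : nat => partition_avg R n m (f n)) =
   (fun n : nat => partition_avg R n m (f n) - partition_avg R n m (h n)
      + partition_avg R n m (h n)).
  by apply/funext => n; rewrite subrK.
by apply: (cvgn_eq _ _ (0 + l)); [rewrite add0r|exact: cvgD].
Qed.

(** * Sample mean and sample variance *)

Lemma partition_avgZ (R : realType) (n m : nat) (c : R) (f : seq nat -> R) :
  partition_avg R n m (fun k => c * f k) = c * partition_avg R n m f.
Proof. by rewrite /partition_avg -mulr_sumr mulrCA. Qed.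

Lemma eigenvalue_scaled_dist (R : realType) (alpha : R) (n m : nat)
    (k : seq nat) : (0 < m)%N -> is_intpart n m k ->
  `|eigenvalue_part alpha n m k / n%:R ^+ 2
     - alpha * ((binsum k)%:R / n%:R ^+ 2)| <= m%:R / n%:R.
Proof.
move=> m_gt0 part_k; rewrite mulrA -mulrBl normrM.
rewrite [`|_^-1|]ger0_norm ?invr_ge0 ?exprn_ge0 //.
have -> : m%:R / n%:R = m%:R * n%:R / n%:R ^+ 2 :> R.
  case: n {part_k} => [|n]; first by rewrite expr0n /= invr0 !mulr0.
  by field; rewrite addrC natr1 pnatr_eq0.
by rewrite ler_wpM2r ?invr_ge0 ?exprn_ge0 // eigenvalue_part_dist.
Qed.

Lemma cvg_mean_eigenvalues (R : realType) (alpha : R) (M : nat) : (0 < M)%N ->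
  (fun n : nat => partition_avg R n M.+1
     (fun k => eigenvalue_part alpha n M.+1 k / n%:R ^+ 2))
    @ \oo --> alpha / (M%:R + 2).
Proof.
move=> M_gt0; apply: (cvg_partition_avg_close R _ _
  (fun n k => alpha * ((binsum k)%:R / n%:R ^+ 2)) (fun n => M.+1%:R / n%:R)).
- by move=> n; rewrite divr_ge0.
- apply: (cvgn_eq _ _ (M.+1%:R * 0)); first by rewrite mulr0.
  by apply: cvgM; [exact: cvg_cst|exact: cvg_invn].
- by move=> n k; exact: eigenvalue_scaled_dist.
under eq_fun do rewrite partition_avgZ.
by apply: cvgM; [exact: cvg_cst|exact: cvg_avg_binsum].
Qed.

(** The error [e] of the scaled eigenvalue turns into the error
    [e * (2 * alpha + e)] of its square, because [binsum k <= n ^ 2]. *)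
Lemma cvg_mean_eigenvalues_sqr (R : realType) (alpha : R) (M : nat) :
  (0 < M)%N -> 0 <= alpha ->
  (fun n : nat => partition_avg R n M.+1
     (fun k => (eigenvalue_part alpha n M.+1 k / n%:R ^+ 2) ^+ 2))
    @ \oo --> alpha ^+ 2 *
       ((M%:R + 6) / ((M%:R + 2) * (M%:R + 3) * (M%:R + 4))).
Proof.
move=> M_gt0 alpha_ge0; apply: (cvg_partition_avg_close R _ _
  (fun n k => alpha ^+ 2 * ((binsum k)%:R / n%:R ^+ 2) ^+ 2)
  (fun n => M.+1%:R / n%:R * (2 * alpha + M.+1%:R / n%:R))).
- by move=> n; rewrite mulr_ge0 ?addr_ge0 ?mulr_ge0 ?invr_ge0.
- have cvg_e : (fun n : nat => M.+1%:R / n%:R) @ \oo --> (0 : R).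
    apply: (cvgn_eq _ _ (M.+1%:R * 0)); first by rewrite mulr0.
    by apply: cvgM; [exact: cvg_cst|exact: cvg_invn].
  apply: (cvgn_eq _ _ (0 * (2 * alpha + 0))); first by rewrite mul0r.
  by apply: cvgM => //; apply: cvgD => //; exact: cvg_cst.
- move=> n k part_k.
  have := eigenvalue_scaled_dist R alpha n M.+1 k isT part_k.
  have /and4P[_ _ _ /eqP/(binsum_scaled_le1 R)/andP[]] := part_k.
  move: ((binsum k)%:R / _) (eigenvalue_part _ _ _ _ / _) (M.+1%:R / _).
  move=> q u e q_ge0 q_le1 ue.
  rewrite -exprMn subr_sqr normrM ler_pM //.
  have aq_ge0 : 0 <= alpha * q by rewrite mulr_ge0.
  have aq_le : alpha * q <= alpha by rewrite ler_piMr.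
  by move: ue; rewrite !ler_norml => /andP[? ?]; apply/andP; split; lra.
under eq_fun do rewrite partition_avgZ.
by apply: cvgM; [exact: cvg_cst|exact: cvg_avg_binsum_sqr].
Qed.

(** A single value gives no exception: then both inverted factors vanish, and
    the inverse of zero is zero. *)
Lemma sample_varianceE (R : realType) (x : seq R) : x != [::] ->
  sample_variance x = (1 - (size x)%:R^-1)^-1 *
    ((size x)%:R^-1 * \sum_(y <- x) y ^+ 2 - sample_mean x ^+ 2).
Proof.
move=> x0; have N0 : (size x)%:R != 0 :> R by rewrite pnatr_eq0 size_eq0.
rewrite /sample_variance.
have -> : 1 - (size x)%:R^-1 = ((size x)%:R - 1) / (size x)%:R :> R.
  by rewrite mulrBl divff // mul1r.
rewrite invfM invrK -mulrA; congr (_ * _).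
have sum_x : \sum_(y <- x) y = (size x)%:R * sample_mean x by rewrite mulVKf.
transitivity (\sum_(y <- x)
    (y ^+ 2 - 2 * sample_mean x * y + sample_mean x ^+ 2)).
  by apply: eq_bigr => y _; ring.
rewrite big_split sumrB /= -mulr_sumr sum_x sumr_const_seq -mulr_natl.
by field.
Qed.

Theorem mainTheorem7 (R : realType) (alpha : R) (m : nat)
  (halpha : 0 < alpha) (hm : (2 <= m)%N) :
  ((fun n : nat => sample_mean (eigenvalues alpha n m) / n%:R ^+ 2)
     @ \oo --> alpha / (m%:R + 1))
  /\
  ((fun n : nat => sample_variance (eigenvalues alpha n m) / n%:R ^+ 4)
     @ \oo --> (m%:R - 1) * alpha ^+ 2
                 / ((m%:R + 1) ^+ 2 * (m%:R + 2) * (m%:R + 3))).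
Proof.
case: m hm => // M; rewrite ltnS => M_gt0.
have M0 : 0 <= M%:R :> R by [].
have meanE n : sample_mean (eigenvalues alpha n M.+1) / n%:R ^+ 2 =
    partition_avg R n M.+1
      (fun k => eigenvalue_part alpha n M.+1 k / n%:R ^+ 2).
  by rewrite /sample_mean /partition_avg size_map big_map -mulr_suml mulrA.
have cvg_mean : (fun n : nat =>
    sample_mean (eigenvalues alpha n M.+1) / n%:R ^+ 2) @ \oo -->
    alpha / (M.+1%:R + 1).
  apply: (cvgn_eq _ _ (alpha / (M%:R + 2))).
    by rewrite -[M.+1%:R]natr1 -addrA (_ : 1 + 1 = 2).
  by under eq_fun do rewrite meanE; exact: cvg_mean_eigenvalues.
split=> //.
have cvg_sqr := cvg_mean_eigenvalues_sqr R alpha M M_gt0 (ltW halpha).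
have cvg_invr := cvg_inv_size_intparts R M M_gt0.
apply: (@cvg_trans _ ((fun n : nat =>
   (1 - (size (intparts n M.+1))%:R^-1)^-1 *
   (partition_avg R n M.+1
      (fun k => (eigenvalue_part alpha n M.+1 k / n%:R ^+ 2) ^+ 2)
    - (sample_mean (eigenvalues alpha n M.+1) / n%:R ^+ 2) *
      (sample_mean (eigenvalues alpha n M.+1) / n%:R ^+ 2))) @ \oo)).
  apply: near_eq_cvg; near=> n.
  have nonempty : eigenvalues alpha n M.+1 != [::].
    rewrite -size_eq0 size_map -(pnatr_eq0 R) -[_%:R]mulr1.
    suff : (size (intparts n M.+1))%:R / n%:R ^+ M != 0 :> R.
      by rewrite mulr1; apply: contraNneq => ->; rewrite mul0r.
    near: n.
    apply: (cvgr_neq0 _ (cvg_size_intparts R M M_gt0)).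
    by rewrite mulf_neq0 ?invr_eq0 ?pnatr_eq0 -?lt0n ?fact_gt0.
  have -> : partition_avg R n M.+1
      (fun k => (eigenvalue_part alpha n M.+1 k / n%:R ^+ 2) ^+ 2) =
      (size (intparts n M.+1))%:R^-1 *
        (\sum_(y <- eigenvalues alpha n M.+1) y ^+ 2) / n%:R ^+ 4.
    rewrite /partition_avg big_map -mulrA mulr_suml; congr (_ * _).
    by apply: eq_bigr => k _; rewrite expr_div_n -exprM.
  rewrite sample_varianceE // size_map -expr2 expr_div_n -exprM -mulrBl.
  by rewrite mulrA.
apply: (cvgn_eq _ _ ((1 - 0)^-1 * (alpha ^+ 2 *
       ((M%:R + 6) / ((M%:R + 2) * (M%:R + 3) * (M%:R + 4)))
    - alpha / (M.+1%:R + 1) * (alpha / (M.+1%:R + 1))))).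
  rewrite subr0 invr1 mul1r -[M.+1%:R]natr1.
  by field; rewrite !lt0r_neq0 //; lra.
apply: cvgM.
  apply: cvgV; first by rewrite subr0 oner_neq0.
  by apply: cvgB => //; exact: cvg_cst.
by apply: cvgB => //; exact: cvgM.
Unshelve. all: by end_near. Qed.
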